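(* Let $Q$ be a rooted tree quiver. Every rooted tree module over $Q$ is isomorphic to a (finite) direct sum of reduced rooted tree modules over $Q$.
   Context: Fix a field $\Bbbk$. All quivers are finite and all representations are finite dimensional over $\Bbbk$. A tree quiver is a quiver whose underlying undirected graph is a tree (connected, no cycles). A rooted tree quiver is a tree quiver with exactly one vertex $\sigma$ of out-degree zero, called its root. For vertices $x,y$ of a tree quiver $Q$, write $x\leq_Q y$ if there is a (possibly empty) directed path from $x$ to $y$; $Q_{\leq x}$ denotes the subquiver spanned by the vertices $y\leq_Q x$, which is a rooted tree quiver with root $x$. A quiver morphism $f:Q'\to Q$ is a pair of functions on vertices and edges, $f_0$ and $f_1$, respecting sources and targets. A rooted tree quiver over a rooted tree quiver $Q$ is a pair $(T,f_T)$ with $T$ a rooted tree quiver and $f_T:T\to Q$ a quiver morphism sending the root of $T$ to the root of $Q$. A morphism over $Q$ from $(S,f_S)$ to $(T,f_T)$ is a quiver morphism $g:S\to T$, preserving roots, with $f_T\circ g=f_S$. The rooted tree quiver $T$ over $Q$ is reduced if its only endomorphism over $Q$ is the identity. For a quiver morphism $f:Q'\to Q$, the push-forward $f_*:\mathbf{rep}(Q')\to\mathbf{rep}(Q)$ is given by $f_*(V)_x=\bigoplus_{y\in f_0^{-1}(x)}V_y$ and $f_*(V)_\alpha=\sum_{\beta\in f_1^{-1}(\alpha)}V_\beta$. The constant representation $\mathbb{1}_T$ has $\Bbbk$ at every vertex and the identity at every arrow. The linearization of $(T,f_T:T\to Q)$ is $\Bbbk_T:=(f_T)_*(\mathbb{1}_T)\in\mathbf{rep}(Q)$.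 Given $V\in\mathbf{rep}(Q)$ and bases $\mathcal B=\{\mathcal B_x\subseteq V_x\}_{x\in Q_0}$, the coefficient quiver $\Gamma(V;\mathcal B)$ has vertex set $\bigsqcup_{x\in Q_0}\mathcal B_x$, and an arrow from $b\in\mathcal B_x$ to $b'\in\mathcal B_{x'}$ for each arrow $\alpha:x\to x'$ of $Q$ such that the matrix of $V_\alpha$ in the bases $\mathcal B$ has a non-zero coefficient in column $b$ and row $b'$. A representation $V$ is a rooted tree module over $Q$ if there is a choice of bases $\mathcal B$ for which $\Gamma(V;\mathcal B)$ is a rooted tree quiver. A representation $V\in\mathbf{rep}(Q)$ is a reduced rooted tree module over $Q$ if there exist a vertex $x\in Q_0$ and a reduced rooted tree quiver $(T,f_T:T\to Q_{\leq x})$ over $Q_{\leq x}$ such that $V\cong\iota_*(\Bbbk_T)$, where $\iota:Q_{\leq x}\to Q$ is the inclusion. *)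

(* Defs.v *)
From HB Require Import structures.
From mathcomp Require Import all_boot all_algebra.

Set Implicit Arguments.
Unset Strict Implicit.
Unset Printing Implicit Defensive.

Import GRing.Theory VectorInternalTheory.
Local Open Scope ring_scope.

Definition dsum (k : fieldType) (I : finType) (V : I -> vectType k) : Type :=
  {dffun forall i, V i}.

HB.instance Definition _ (k : fieldType) (I : finType) (V : I -> vectType k) :=
  Choice.copy (dsum V) {dffun forall i, V i}.

Section DsumModule.

Context (k : fieldType) (I : finType) (V : I -> vectType k).

Definition dsum_at (i : I) (f : dsum V) : V i :=
  (f : {dffun forall i, V i}) i.

Definition dsum_of (f : forall i, V i) : dsum V := finfun f.

Lemma dsum_ofE (f : forall i, V i) i : dsum_at i (dsum_of f) = f i.
Proof. exact: ffunE. Qed.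

Lemma dsumP (f g : dsum V) : (forall i, dsum_at i f = dsum_at i g) <-> f = g.
Proof. exact: ffunP. Qed.

Definition dsum_zero : dsum V := dsum_of (fun i => 0).
Definition dsum_opp (f : dsum V) : dsum V := dsum_of (fun i => - dsum_at i f).
Definition dsum_add (f g : dsum V) : dsum V :=
  dsum_of (fun i => dsum_at i f + dsum_at i g).
Definition dsum_scale (a : k) (f : dsum V) : dsum V :=
  dsum_of (fun i => a *: dsum_at i f).

Fact dsum_addA : associative dsum_add.
Proof. by move=> f g h; apply/dsumP => i; rewrite !dsum_ofE addrA. Qed.
Fact dsum_addC : commutative dsum_add.
Proof. by move=> f g; apply/dsumP => i; rewrite !dsum_ofE addrC. Qed.
Fact dsum_add0 : left_id dsum_zero dsum_add.
Proof. by move=> f; apply/dsumP => i; rewrite !dsum_ofE add0r. Qed.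
Fact dsum_addN : left_inverse dsum_zero dsum_opp dsum_add.
Proof. by move=> f; apply/dsumP => i; rewrite !dsum_ofE addNr. Qed.

HB.instance Definition _ := GRing.isZmodule.Build (dsum V)
  dsum_addA dsum_addC dsum_add0 dsum_addN.

Fact dsum_scaleA a b f : dsum_scale a (dsum_scale b f) = dsum_scale (a * b) f.
Proof. by apply/dsumP => i; rewrite !dsum_ofE scalerA. Qed.
Fact dsum_scale1 : left_id 1 dsum_scale.
Proof. by move=> f; apply/dsumP => i; rewrite !dsum_ofE scale1r. Qed.
Fact dsum_scaleDr : right_distributive dsum_scale +%R.
Proof. by move=> a f g; apply/dsumP => i; rewrite !dsum_ofE scalerDr. Qed.
Fact dsum_scaleDl f : {morph dsum_scale^~ f : a b / a + b}.
Proof. by move=> a b; apply/dsumP => i; rewrite !dsum_ofE scalerDl. Qed.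

HB.instance Definition _ := GRing.Zmodule_isLmodule.Build k (dsum V)
  dsum_scaleA dsum_scale1 dsum_scaleDr dsum_scaleDl.

Fact dsum_vect_iso :
  Vector.axiom (\sum_(j < #|I|) dim (V (enum_val j))) (dsum V).
Proof.
exists (fun f : dsum V => \mxrow_j v2r (dsum_at (enum_val j) f)).
  move=> a f g; rewrite -[a *: (\mxrow_j _)]mul_scalar_mx mul_mxrow -mxrowD.
  by apply: eq_mxrow => j; rewrite mul_scalar_mx !dsum_ofE linearP.
exists (fun r => dsum_of (fun i =>
    ecast j (V j) (enum_rankK i) (r2v (submxrow r (enum_rank i))))) => [f|r].
  apply/dsumP => i; rewrite dsum_ofE mxrowK v2rK.
  by move: (enum_val _) (enum_rankK i) => j e; case: i / e.
apply/mxrowP => j; rewrite mxrowK dsum_ofE.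
move: (enum_rank _) (esym (enum_valK j)) (enum_rankK _) => j' jj'.
case: j' / jj' => e.
by rewrite eq_axiomK r2vK.
Qed.

HB.instance Definition _ := Lmodule_hasFinDim.Build k (dsum V) dsum_vect_iso.

Fact dsum_at_linear i : linear (@dsum_at i).
Proof. by move=> a f g; rewrite !dsum_ofE. Qed.

HB.instance Definition _ i :=
  GRing.isLinear.Build k (dsum V) (V i) _ (@dsum_at i) (@dsum_at_linear i).

Definition dsum_proj (i : I) : 'Hom(dsum V, V i) := linfun (@dsum_at i).

Definition dsum_single (i : I) (v : V i) : dsum V :=
  dsum_of (dfwith (T := V) (fun=> 0) v).

Fact dsum_single_linear i : linear (@dsum_single i).
Proof.
move=> a u v; apply/dsumP => j; rewrite !dsum_ofE.
rewrite /dfwith; case: eqP => [ij|_]; last by rewrite scaler0 addr0.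
by case: _ / ij.
Qed.

HB.instance Definition _ i :=
  GRing.isLinear.Build k (V i) (dsum V) _ (@dsum_single i)
    (@dsum_single_linear i).

Definition dsum_inj (i : I) : 'Hom(V i, dsum V) := linfun (@dsum_single i).

Lemma dsum_projE i f : dsum_proj i f = dsum_at i f.
Proof. by rewrite lfunE. Qed.

Lemma dsum_injE i v j :
  dsum_at j (dsum_inj i v) = dfwith (T := V) (fun=> 0) v j.
Proof. by rewrite lfunE dsum_ofE. Qed.

End DsumModule.

Record quiver := Quiver {
  vertex : finType;
  arrow : finType;
  src : arrow -> vertex;
  tgt : arrow -> vertex }.

Section Trees.

Variable Q : quiver.
Implicit Types x y : vertex Q.

Definition arrow_rel : rel (vertex Q) :=
  [rel x y | [exists a : arrow Q, (src a == x) && (tgt a == y)]].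

Definition edge_rel : rel (vertex Q) :=
  [rel x y | arrow_rel x y || arrow_rel y x].

Definition is_connected : Prop :=
  (0 < #|vertex Q|)%N /\ forall x y, connect edge_rel x y.

(* A step of an undirected walk: an arrow traversed forwards if the boolean is
   true, and backwards otherwise. *)
Definition step : Type := (arrow Q * bool)%type.
Definition step_src (s : step) := if s.2 then src s.1 else tgt s.1.
Definition step_tgt (s : step) := if s.2 then tgt s.1 else src s.1.

(* The underlying graph is a multigraph: a loop is a cycle of length 1 and two
   parallel (or opposite) arrows form a cycle of length 2. *)
Definition is_graph_cycle (c : seq step) : bool :=
  [&& (0 < size c)%N, cycle [rel s t | step_tgt s == step_src t] c,
      uniq [seq step_src s | s <- c] & uniq [seq s.1 | s <- c]].

Definition is_tree : Prop :=
  is_connected /\ forall c : seq step, ~~ is_graph_cycle c.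

Definition out_degree x : nat := #|[pred a : arrow Q | src a == x]|.

Definition is_root x : bool := out_degree x == 0%N.

Definition is_rooted_tree : Prop := is_tree /\ exists! x, is_root x.

Definition leQ x y : bool := connect arrow_rel x y.

End Trees.

Record qmor (Q' Q : quiver) := QMor {
  qmor0 : vertex Q' -> vertex Q;
  qmor1 : arrow Q' -> arrow Q;
  qmor_src : forall a, src (qmor1 a) = qmor0 (src a);
  qmor_tgt : forall a, tgt (qmor1 a) = qmor0 (tgt a) }.

Section Subquiver.

Variables (Q : quiver) (P : pred (vertex Q)).

Definition sub_vertex : finType := {x : vertex Q | P x}.
Definition sub_arrow : finType := {a : arrow Q | P (src a) && P (tgt a)}.

Definition sub_src (a : sub_arrow) : sub_vertex :=
  exist _ (src (val a)) (proj1 (andP (valP a))).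
Definition sub_tgt (a : sub_arrow) : sub_vertex :=
  exist _ (tgt (val a)) (proj2 (andP (valP a))).

Definition full_subquiver : quiver := Quiver sub_src sub_tgt.

Definition subquiver_incl : qmor full_subquiver Q :=
  @QMor full_subquiver Q val val (fun=> erefl) (fun=> erefl).

End Subquiver.

Definition down_quiver (Q : quiver) (x : vertex Q) : quiver :=
  full_subquiver (fun y => leQ y x).

Definition down_incl (Q : quiver) (x : vertex Q) : qmor (down_quiver x) Q :=
  subquiver_incl (fun y => leQ y x).

(* Used for rooted tree quivers only, where the root is the unique vertex
   satisfying [is_root]. *)
Definition preserves_root (Q' Q : quiver) (f : qmor Q' Q) : Prop :=
  forall x, is_root x -> is_root (qmor0 f x).

Definition is_rooted_tree_over (T Q : quiver) (f : qmor T Q) : Prop :=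
  is_rooted_tree T /\ preserves_root f.

Definition is_mor_over (S T Q : quiver) (fS : qmor S Q) (fT : qmor T Q)
    (g : qmor S T) : Prop :=
  [/\ preserves_root g,
      qmor0 fT \o qmor0 g =1 qmor0 fS
    & qmor1 fT \o qmor1 g =1 qmor1 fS].

Definition is_reduced (T Q : quiver) (f : qmor T Q) : Prop :=
  forall g : qmor T T, is_mor_over f f g -> qmor0 g =1 id /\ qmor1 g =1 id.

Record rep (k : fieldType) (Q : quiver) := Rep {
  rep_space :> vertex Q -> vectType k;
  rep_map : forall a : arrow Q, 'Hom(rep_space (src a), rep_space (tgt a)) }.

Section Rep.

Variable k : fieldType.

Definition rep_iso (Q : quiver) (V W : rep k Q) : Prop :=
  exists phi : forall x, 'Hom(V x, W x),
    (forall x, bijective (phi x)) /\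
    (forall a : arrow Q,
      (phi (tgt a) \o rep_map V a = rep_map W a \o phi (src a))%VF).

Definition rep_dsum (Q : quiver) (I : finType) (W : I -> rep k Q) : rep k Q :=
  @Rep k Q (fun x => dsum (fun i => W i x))
    (fun a => \sum_i (dsum_inj (fun i => W i (tgt a)) i
                      \o rep_map (W i) a
                      \o dsum_proj (fun i => W i (src a)) i)%VF).

Section Pushforward.

Variables (Q' Q : quiver) (f : qmor Q' Q) (V : rep k Q').

Definition fiber0 (x : vertex Q) : finType := {y : vertex Q' | qmor0 f y == x}.
Definition fiber1 (a : arrow Q) : finType := {b : arrow Q' | qmor1 f b == a}.

Fact fiber_src_proof (a : arrow Q) (b : fiber1 a) :
  qmor0 f (src (val b)) == src a.
Proof. by rewrite -qmor_src (eqP (valP b)). Qed.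

Fact fiber_tgt_proof (a : arrow Q) (b : fiber1 a) :
  qmor0 f (tgt (val b)) == tgt a.
Proof. by rewrite -qmor_tgt (eqP (valP b)). Qed.

Definition fiber_src (a : arrow Q) (b : fiber1 a) : fiber0 (src a) :=
  exist _ (src (val b)) (fiber_src_proof b).
Definition fiber_tgt (a : arrow Q) (b : fiber1 a) : fiber0 (tgt a) :=
  exist _ (tgt (val b)) (fiber_tgt_proof b).

Definition fiber_space (x : vertex Q) (y : fiber0 x) : vectType k := V (val y).

Definition pushforward : rep k Q :=
  @Rep k Q (fun x => dsum (@fiber_space x))
    (fun a => \sum_(b : fiber1 a)
       (dsum_inj (@fiber_space (tgt a)) (fiber_tgt b)
        \o rep_map V (val b)
        \o dsum_proj (@fiber_space (src a)) (fiber_src b))%VF).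

End Pushforward.

Definition constant_rep (Q : quiver) : rep k Q :=
  @Rep k Q (fun=> k^o) (fun=> \1%VF).

Definition linearization (T Q : quiver) (f : qmor T Q) : rep k Q :=
  pushforward f (constant_rep T).

Section CoefficientQuiver.

Variables (Q : quiver) (V : rep k Q).

(* The bases are enumerated by tuples; the vertex (x, i) of the coefficient
   quiver stands for the i-th vector of the basis of V x. *)
Variable B : forall x, (\dim {:V x}).-tuple (V x).

Definition coef_vertex : finType := {x : vertex Q & 'I_(\dim {:V x})}.

Definition coef_index : finType :=
  {a : arrow Q & 'I_(\dim {:V (src a)}) * 'I_(\dim {:V (tgt a)})}%type.

Definition coefficient (e : coef_index) : k :=
  let: existT a (j, i) := e in
  coord (B (tgt a)) i (rep_map V a (B (src a))`_j).

Definition coef_arrow : finType := {e : coef_index | coefficient e != 0}.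

Definition coef_src (e : coef_arrow) : coef_vertex :=
  let: existT a (j, i) := val e in
  existT (fun x => 'I_(\dim {:V x})) (src a) j.

Definition coef_tgt (e : coef_arrow) : coef_vertex :=
  let: existT a (j, i) := val e in
  existT (fun x => 'I_(\dim {:V x})) (tgt a) i.

Definition coef_quiver : quiver := Quiver coef_src coef_tgt.

End CoefficientQuiver.

Definition is_rooted_tree_module (Q : quiver) (V : rep k Q) : Prop :=
  exists B : forall x, (\dim {:V x}).-tuple (V x),
    (forall x, basis_of {:V x} (B x)) /\ is_rooted_tree (coef_quiver B).

Definition is_reduced_rooted_tree_module (Q : quiver) (V : rep k Q) : Prop :=
  exists (x : vertex Q) (T : quiver) (f : qmor T (down_quiver x)),
    [/\ is_rooted_tree_over f, is_reduced f
      & rep_iso V (pushforward (down_incl x) (linearization f))].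

End Rep.

(* Main.v *)
From HB Require Import structures.
Require Import Defs.
From mathcomp Require Import all_boot all_algebra.

(** In a rooted tree every vertex has at most one outgoing arrow, so rescaling
    a tree basis along the paths to the root makes all coefficients equal to 1:
    the module becomes the linearization of its coefficient quiver [T].  More
    generally, keep only a set [C] of arrows of [T], so that [T] becomes a
    forest.  If a component of it is not reduced, a non-identity endomorphism
    moves some vertex [y] whose parent it fixes, and thus maps the subtree [D]
    above [y] into the subtree above a sibling of [y].  Replacing [e_w] by
    [e_w - e_(h w)] for [w] in [D] is a change of basis (its nilpotent part has
    square 0) after which the arrow out of [y] acts as 0; so that arrow can be
    removed from [C] without changing the module.  When no such arrow is left
    all components are reduced, and the module is the direct sum of their
    linearizations. *)

Set Implicit Arguments.
Unset Strict Implicit.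
Unset Printing Implicit Defensive.

Import GRing.Theory.
Local Open Scope ring_scope.

(** * Walks in trees *)

Section TreeWalks.

Variable Q : quiver.
Implicit Types (s t : step Q) (a b : arrow Q) (x y z : vertex Q).

(** Only immediate backtracking is excluded: a walk that goes back along its last arrow can close up
    without containing a cycle. *)
Definition reduced_next : rel (step Q) :=
  [rel s t | (step_tgt s == step_src t) && ~~ ((s.1 == t.1) && (s.2 != t.2))].

Lemma reduced_walk_src s p :
  path reduced_next s p ->
  [seq step_src t | t <- p] = belast (step_tgt s) [seq step_tgt t | t <- p].
Proof. by elim: p s => //= t p IH s /andP[/andP[/eqP -> _] /IH ->]. Qed.

(** An arrow used twice in the same direction repeats a source. If the arrow of [s] returns in the
    opposite direction as [u], then [u] starts where the next step [t] starts, so either [u] is [t],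
    which is backtracking, or a source is repeated. *)
Lemma reduced_walk_uniq_arrows s p :
  path reduced_next s p -> uniq [seq step_src t | t <- s :: p] ->
  uniq [seq t.1 | t <- s :: p].
Proof.
elim: p s => //= t p IH s /andP[/andP[/eqP st nst] tp].
move=> /andP[s_notin up]; rewrite IH // andbT.
rewrite -[_ :: map _ _]/[seq v.1 | v <- t :: p].
apply/negP => /mapP[u u_in su].
have u_neq_s : step_src u != step_src s.
  apply: contraNneq s_notin => <-.
  by rewrite -[_ :: map _ _]/(map (@step_src Q) (t :: p)) map_f.
have dir : s.2 != u.2.
  by apply: contraNneq u_neq_s; rewrite /step_src su => ->.
have srcu : step_src u = step_src t.
  by rewrite -st /step_src /step_tgt su; move: dir; case: s.2; case: u.2.
move: u_in; rewrite inE => /orP[/eqP ut | up'].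
  by case/negP: nst; rewrite su -ut eqxx /= ut in dir *.
by case/andP: up => /negP[]; rewrite -srcu map_f.
Qed.

Hypothesis no_cycle : forall c, ~~ @is_graph_cycle Q c.

Lemma reduced_walk_uniq s p :
  path reduced_next s p ->
  uniq (step_src s :: [seq step_tgt t | t <- s :: p]).
Proof.
elim: p s => [|t p IH] s.
  move=> _ /=; rewrite inE andbT; apply/negP => /eqP loop.
  by have := no_cycle [:: s]; rewrite /is_graph_cycle /= loop eqxx.
move=> stp; case/andP: (stp : _ && _) => /andP[/eqP st _] /IH up.
rewrite cons_uniq; apply/andP; split; last by move: up => /=; rewrite st.
apply/negP => s_in; pose q := [seq step_tgt u | u <- s :: t :: p].
(* The first return to the start closes the prefix [s :: take i (t :: p)]. Minimality of [i] and the
   induction hypothesis make its sources distinct, so it is a graph cycle. *)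
pose i := index (step_src s) q.
have i_lt : (i < size (s :: t :: p))%N by rewrite -(size_map (@step_tgt Q)) index_mem.
have i_le : (i <= size (t :: p))%N by [].
have [p1p last_s nin] : [/\ path reduced_next s (take i (t :: p)),
    step_tgt (last s (take i (t :: p))) = step_src s
  & step_src s \notin take i q].
- split; first by move: stp; rewrite -{1}(cat_take_drop i (t :: p)) cat_path => /andP[].
  + have := nth_index (step_src s) s_in; rewrite -/i (nth_map s) // => <-.
    by rewrite (last_nth s) size_takel // -[s :: take _ _]/(take i.+1 (s :: t :: p)) nth_take.
  + by rewrite in_take ?ltnn.
have usrc : uniq [seq step_src u | u <- s :: take i (t :: p)].
  rewrite /= (reduced_walk_src p1p).
  have -> : belast (step_tgt s) [seq step_tgt t | t <- take i (t :: p)] = take i q.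
    rewrite map_take /q /=; move: i_le; clear.
    move: (step_tgt s) => z; rewrite -[_ :: map _ _]/(map (@step_tgt Q) (t :: p)).
    rewrite -(size_map (@step_tgt Q)); move: (map _ _) => r.
    by elim: r i z => [|y r IH] [|i] z //= ile; rewrite IH.
  by rewrite nin take_uniq // /q /= st.
move: (take i (t :: p)) p1p last_s usrc => p1 p1p last_s usrc.
have := no_cycle (s :: p1).
rewrite /is_graph_cycle usrc reduced_walk_uniq_arrows // !andbT /=.
rewrite rcons_path /= last_s eqxx andbT.
by rewrite (sub_path _ p1p) // => u v /andP[].
Qed.

Lemma reduced_walk_open s p :
  path reduced_next s p -> step_tgt (last s p) != step_src s.
Proof.
move/reduced_walk_uniq => /= /andP[+ _]; apply: contraNneq => <-.
by rewrite -[_ :: _]/(map (@step_tgt Q) (s :: p)) map_f // mem_last.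
Qed.

End TreeWalks.

(** * Directed walks and paths to the root *)

Section DirectedWalks.

Variable Q : quiver.
Implicit Types (a b : arrow Q) (x y z : vertex Q) (p q : seq (arrow Q)).

Fixpoint walk x p y : bool :=
  if p is a :: p' then (src a == x) && walk (tgt a) p' y else x == y.

Lemma walk_rcons x p a y : walk x (rcons p a) y = walk x p (src a) && (tgt a == y).
Proof.
elim: p x => [|b p IH] x /=; first by rewrite eq_sym.
by rewrite IH andbA.
Qed.

Lemma walk_connect x y : reflect (exists p, walk x p y) (connect (@arrow_rel Q) x y).
Proof.
apply: (iffP connectP) => [[p] | [p]].
  elim: p x => [|z p IH] x /=; first by move=> _ ->; exists [::] => /=.
  move=> /andP[/existsP[a /andP[/eqP ax /eqP az]] /IH zp] /zp[q wq].
  by exists (a :: q); rewrite /= ax az eqxx.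
elim: p x => [|a p IH] x /=; first by move=> /eqP ->; exists [::].
move=> /andP[/eqP ax /IH[q qp ql]]; exists (tgt a :: q) => //=.
by rewrite qp andbT; apply/existsP; exists a; rewrite ax !eqxx.
Qed.

Definition has_no_dicycle := forall a, ~~ connect (@arrow_rel Q) (tgt a) (src a).

Lemma arrow_rel_arrow a : arrow_rel (src a) (tgt a).
Proof. by apply/existsP; exists a; rewrite !eqxx. Qed.

Hypothesis no_cycle : forall c, ~~ @is_graph_cycle Q c.

(** A directed walk traverses all its arrows in the same direction, so it cannot backtrack; the same
    goes for its reversal, treated next. *)
Lemma walk_fwd_path a p x y : walk x (a :: p) y ->
  path (@reduced_next Q) (a, true) [seq (b, true) | b <- p] /\
  step_tgt (last (a, true) [seq (b, true) | b <- p]) = y.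
Proof.
move=> /= /andP[_]; elim: p a => [|b p IH] a /=; first by move=> /eqP.
by move=> /andP[/eqP ba /IH[-> ->]]; rewrite /reduced_next /= /step_tgt /step_src /= ba eqxx andbF.
Qed.

Lemma walk_bwd_path a p x y : walk x (rcons p a) y ->
  path (@reduced_next Q) (a, false) [seq (b, false) | b <- rev p] /\
  step_tgt (last (a, false) [seq (b, false) | b <- rev p]) = x.
Proof.
rewrite walk_rcons => /andP[+ _].
elim/last_ind: p a => [|p b IH] a /=; first by move=> /eqP.
rewrite walk_rcons rev_rcons /= => /andP[/IH[-> ->] /eqP ba].
by rewrite /reduced_next /= /step_tgt /step_src /= ba eqxx andbF.
Qed.

Lemma tree_closed_walk x p : walk x p x -> p = [::].
Proof.
case: p => // a p wp; have [pp lp] := walk_fwd_path wp.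
have := reduced_walk_open no_cycle pp; rewrite lp /step_src /=.
by case/andP: wp => /eqP ->; rewrite eqxx.
Qed.

Lemma tree_no_dicycle : has_no_dicycle.
Proof.
move=> a; apply/negP => /walk_connect[p wp].
by have /tree_closed_walk : walk (src a) (a :: p) (src a) by rewrite /= eqxx.
Qed.

(** Compare the last arrows. If they differ, [p] followed by the reversal of [q] turns around at [y]
    without backtracking, which gives a closed reduced walk. *)
Lemma tree_walk_inj x y p q : walk x p y -> walk x q y -> p = q.
Proof.
elim/last_ind: p q y => [|p a IH] q y.
  by move=> /eqP <- /tree_closed_walk ->.
case/lastP: q => [|q b].
  by move=> wp /eqP exy; move: wp; rewrite -exy => /tree_closed_walk.
have [<- | neq_ab] := eqVneq a b.
  by rewrite !walk_rcons => /andP[/IH wp _] /andP[/wp -> _].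
move=> wp wq; have [qp ql] := walk_bwd_path wq.
have tab : tgt a = tgt b.
  by move: wp wq; rewrite !walk_rcons => /andP[_ /eqP ->] /andP[_ /eqP ->].
move: wp; rewrite headI => wp; have [pp pl] := walk_fwd_path wp.
set c := head a p in wp pp pl.
have := @reduced_walk_open Q no_cycle (c, true)
  ([seq (b, true) | b <- behead (rcons p a)] ++
   (b, false) :: [seq (b, false) | b <- rev q]).
rewrite cat_path pp /= qp andbT last_cat /= ql.
have -> : last (c, true) [seq (b, true) | b <- behead (rcons p a)] = (a, true).
  rewrite -[(c, true)]/((fun b => (b, true)) c) last_map; congr pair.
  by rewrite /c; case: (p) => //= ? ?; rewrite last_rcons.
rewrite /reduced_next /= /step_tgt /step_src /= tab eqxx (negPf neq_ab) /=.
by move/(_ isT); case/andP: wp => /eqP -> _; rewrite eqxx.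
Qed.

End DirectedWalks.

Section Acyclic.

Variable Q : quiver.
Hypothesis acycQ : has_no_dicycle Q.

(** A measure for inductions towards the root: it drops along every arrow, because the source is not
    reachable from the target. *)
Definition height (x : vertex Q) := #|connect (@arrow_rel Q) x|.

Lemma height_arrow (a : arrow Q) : (height (tgt a) < height (src a))%N.
Proof.
apply: proper_card; apply/properP; split.
  apply/subsetP => y; rewrite !unfold_in => /=; apply: connect_trans.
  exact/connect1/arrow_rel_arrow.
by exists (src a); [exact: connect0 | exact: acycQ].
Qed.

Lemma walk_to_root (x : vertex Q) : exists2 r, is_root r & exists p, walk x p r.
Proof.
have [n] := ubnP (height x); elim: n x => // n IH x; rewrite ltnS => le_n.
have [rx | ] := boolP (is_root x).
  by exists x => //; exists [::] => /=.
rewrite /is_root /out_degree -lt0n => /card_gt0P[a]; rewrite inE => /eqP ax.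
have [|r rr [p wp]] := IH (tgt a).
  by apply: leq_trans (height_arrow a) _; rewrite ax.
by exists r => //; exists (a :: p); rewrite /= ax eqxx.
Qed.

End Acyclic.

Lemma rooted_tree_no_dicycle Q : is_rooted_tree Q -> has_no_dicycle Q.
Proof. by move=> [[_ nc] _]; apply: tree_no_dicycle. Qed.

(** Both arrows extend to directed walks to the unique root, and directed walks with the same ends
    are equal. *)
Lemma rooted_tree_src_inj Q : is_rooted_tree Q -> injective (@src Q).
Proof.
move=> treeQ; have acycQ := rooted_tree_no_dicycle treeQ.
case: treeQ => [[_ nc] [r [_ r_uniq]]] a b ab.
have [_ /r_uniq <- [p wp]] := walk_to_root acycQ (tgt a).
have [_ /r_uniq <- [q wq]] := walk_to_root acycQ (tgt b).
have := @tree_walk_inj Q nc (src a) r (a :: p) (b :: q).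
by rewrite /= ab eqxx => /(_ wp wq)[].
Qed.

(** * Representations with a basis indexed by a quiver *)

Section Presentation.

Variables (k : fieldType) (T Q : quiver) (F : qmor T Q).

(* [e x v] is meaningful for [v] in the fiber over [x] and 0 otherwise;
   [co x v] is the coordinate functional dual to [e x v]. *)
Definition fiber_bases (V : rep k Q) (e : forall x, vertex T -> V x)
    (co : forall x, vertex T -> 'Hom(V x, k^o)) : Prop :=
  [/\ forall x v, qmor0 F v != x -> e x v = 0,
      forall x v w, qmor0 F v = x -> co x w (e x v) = (v == w)%:R
    & forall x u, u = \sum_v co x v u *: e x v].

Definition arrows_act (C : {set arrow T}) (V : rep k Q)
    (e : forall x, vertex T -> V x) : Prop :=
  (forall c, c \in C -> rep_map V (qmor1 F c) (e (src (qmor1 F c)) (src c)) =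
                        e (tgt (qmor1 F c)) (tgt c)) /\
  (forall a v, (forall c, c \in C -> src c != v) ->
               rep_map V a (e (src a) v) = 0).

(* For [src] injective on [Q], this says that [V] is isomorphic to the
   linearization of the subquiver of [T] with all vertices and arrows [C]. *)
Definition presented (C : {set arrow T}) (V : rep k Q) : Prop :=
  exists (e : forall x, vertex T -> V x)
         (co : forall x, vertex T -> 'Hom(V x, k^o)),
    fiber_bases e co /\ arrows_act C e.

(** The duality condition also covers [co x v] for [v] outside of the fiber: this functional
    vanishes on all basis vectors. *)
Lemma coord_out (V : rep k Q) e co x v u :
  @fiber_bases V e co -> qmor0 F v != x -> co x v u = 0.
Proof.
move=> [e0 cod ex] vx; rewrite {1}(ex x u) linear_sum big1 // => w _.
rewrite linearZ /=; have [wx | wx] := eqVneq (qmor0 F w) x.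
  rewrite cod //; have [wv | _] := eqVneq; last by rewrite scaler0.
  by rewrite -wv wx eqxx in vx.
by rewrite e0 // linear0 scaler0.
Qed.

Lemma fiber_bases_hom_ext (V : rep k Q) e co x (W : vectType k) (f g : 'Hom(V x, W)) :
  @fiber_bases V e co -> (forall v, qmor0 F v = x -> f (e x v) = g (e x v)) ->
  f = g.
Proof.
move=> [e0 _ ex] fg; apply/lfunP => u; rewrite (ex x u) !linear_sum.
apply: eq_bigr => v _; rewrite !linearZ /=; congr (_ *: _).
by have [/fg // | vx] := eqVneq (qmor0 F v) x; rewrite e0 // !linear0.
Qed.

(** The family [e] need not be a basis: besides isomorphisms, this also produces the nilpotent map
    used to cut an arrow. *)
Definition basis_hom (V W : rep k Q) (co : forall x, vertex T -> 'Hom(V x, k^o))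
    (e : forall x, vertex T -> W x) x : 'Hom(V x, W x) :=
  linfun (fun u => \sum_v co x v u *: e x v).

Lemma basis_hom_sum (V W : rep k Q) co e x u :
  @basis_hom V W co e x u = \sum_v co x v u *: e x v.
Proof.
pose f u := \sum_v co x v u *: e x v.
(* [linfun] can be evaluated only on functions with a linear structure, so one is built for [f]. *)
have fl : linear f.
  move=> a u1 u2; rewrite /f scaler_sumr -big_split; apply: eq_bigr => v _ /=.
  by rewrite linearP scalerDl scalerA.
pose fL := GRing.isLinear.Build k (V x) (W x) _ f fl.
pose fH : {linear V x -> W x} := HB.pack f fL.
by rewrite -[_ u]/(linfun fH u) lfunE.
Qed.

Lemma basis_homE (V W : rep k Q) eV coV eW x v :
  @fiber_bases V eV coV -> (forall w, qmor0 F w != x -> eW x w = 0 :> W x) ->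
  basis_hom coV eW x (eV x v) = eW x v.
Proof.
move=> [eV0 codV _] eW0; rewrite basis_hom_sum.
have [vx | vx] := eqVneq (qmor0 F v) x.
  rewrite (bigD1 v) //= codV // eqxx scale1r big1 ?addr0 // => w wv.
  by rewrite codV // eq_sym (negPf wv) scale0r.
by rewrite eV0 // eW0 // big1 // => w _; rewrite linear0 scale0r.
Qed.

Lemma basis_homK (V W : rep k Q) eV coV eW coW x :
  @fiber_bases V eV coV -> @fiber_bases W eW coW ->
  cancel (basis_hom coV eW x) (basis_hom coW eV x).
Proof.
move=> fV fW u; rewrite -comp_lfunE -[RHS]id_lfunE; move: u; apply/lfunP.
apply: (fiber_bases_hom_ext fV) => v _; rewrite comp_lfunE id_lfunE.
have [[eV0 _ _] [eW0 _ _]] := (fV, fW).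
by rewrite (basis_homE _ fV) ?(basis_homE _ fW) //; [exact: eV0 | exact: eW0].
Qed.

Hypothesis srcQ : injective (@src Q).

(** Basis vectors with the same index are matched. An arrow [c] of [C] out of [v] must lie over [a],
    since [src] is injective on [Q]; without such a [c], both representations kill the vector. *)
Lemma presented_iso C V W : presented C V -> presented C W -> rep_iso V W.
Proof.
move=> [eV [coV [fV [mV zV]]]] [eW [coW [fW [mW zW]]]].
exists (basis_hom coV eW); split=> [x | a].
  by exists (basis_hom coW eV x); apply: basis_homK.
apply: (fiber_bases_hom_ext fV) => v va; rewrite !comp_lfunE.
have [eW0 _ _] := fW; rewrite (basis_homE _ fV); last exact: eW0.
have [/existsP[c /andP[cC /eqP cv]] | no_c] :=
    boolP [exists c, (c \in C) && (src c == v)].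
  have ac : qmor1 F c = a by apply: srcQ; rewrite qmor_src cv.
  by case: a / ac va => _; rewrite -cv mV // mW // (basis_homE _ fV) //; exact: eW0.
have no_c' c : c \in C -> src c != v.
  by move=> cC; apply: contraNneq no_c => cv; apply/existsP; exists c; rewrite cC cv /=.
by rewrite zV // zW // linear0.
Qed.

Lemma fiber_bases_change (V : rep k Q) e co (f g : forall x, 'Hom(V x, V x)) :
  (forall x, cancel (f x) (g x)) -> (forall x, cancel (g x) (f x)) ->
  @fiber_bases V e co ->
  @fiber_bases V (fun x v => f x (e x v)) (fun x v => (co x v \o g x)%VF).
Proof.
move=> fK gK [e0 cod ex]; split=> [x v vx | x v w vx | x u].
- by rewrite e0 // linear0.
- by rewrite comp_lfunE fK cod.
rewrite -{1}[u]gK {1}(ex x (g x u)) linear_sum; apply: eq_bigr => v _.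
by rewrite linearZ comp_lfunE.
Qed.

End Presentation.

(** * Presentations of constant representations and push-forwards *)

Section Constant.

Variables (k : fieldType) (T : quiver).

Definition qmor_id : qmor T T := @QMor T T id id (fun=> erefl) (fun=> erefl).

Lemma presented_constant : presented qmor_id setT (constant_rep k T).
Proof.
(* The fiber over [x] is [x] alone: the families are 1 and the identity there, with the default 0
   elsewhere. *)
exists (fun x v => (v == x)%:R), (fun x v => (v == x)%:R *: \1%VF).
split; split=> /=.
- by move=> x v /negPf ->.
- by move=> x v w <-; rewrite eqxx scale_lfunE id_lfunE eq_sym -[LHS]/(_ * 1) mulr1.
- move=> x u; rewrite (bigD1 x) //= big1 => [|v /negPf ->].
    by rewrite eqxx scale1r id_lfunE addr0 -[_ *: _]/(u * 1) mulr1.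
  by rewrite scaler0.
- by move=> c _; rewrite id_lfunE !eqxx.
- move=> a v /(_ a (in_setT a)); rewrite eq_sym => /negPf ->.
  by rewrite linear0.
Qed.

End Constant.

Section Pushforward.

Variables (k : fieldType) (T Q' Q : quiver) (F : qmor T Q') (g : qmor Q' Q).

Fact qmor_comp_src c : src (qmor1 g (qmor1 F c)) = qmor0 g (qmor0 F (src c)).
Proof. by rewrite !qmor_src. Qed.
Fact qmor_comp_tgt c : tgt (qmor1 g (qmor1 F c)) = qmor0 g (qmor0 F (tgt c)).
Proof. by rewrite !qmor_tgt. Qed.
Definition qmor_comp : qmor T Q :=
  @QMor T Q (qmor0 g \o qmor0 F) (qmor1 g \o qmor1 F)
    qmor_comp_src qmor_comp_tgt.

(** The new basis vector of [v] is the old one in the summand at [qmor0 F v] and 0 in all others.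
    Arrows of [Q'] being determined by their sources, at most one term of the push-forward map is
    non-zero on it. *)
Lemma presented_pushforward C (V : rep k Q') : injective (@src Q') ->
  presented F C V -> presented qmor_comp C (pushforward g V).
Proof.
move=> srcQ' [e [co [fb [ma za]]]]; have [e0 cod ex] := fb.
pose E x v : pushforward g V x :=
  dsum_of (fun y : fiber0 g x => e (val y) v : fiber_space V y).
pose CO x v : 'Hom(pushforward g V x, k^o) :=
  (\sum_(y : fiber0 g x) (co (val y) v \o dsum_proj (@fiber_space _ _ _ g V x) y)%VF).
have COE x v (u : pushforward g V x) :
    CO x v u = \sum_(y : fiber0 g x) co (val y) v (dsum_at y u).
  by rewrite sum_lfunE; apply: eq_bigr => y _; rewrite comp_lfunE dsum_projE.
have mapE a u (y : fiber0 g (tgt a)) : dsum_at y (rep_map (pushforward g V) a u) =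
    \sum_(b : fiber1 g a) dsum_at y (dsum_inj (@fiber_space _ _ _ g V (tgt a)) (fiber_tgt b)
       (rep_map V (val b) (dsum_at (fiber_src b) u))).
  rewrite /= sum_lfunE linear_sum; apply: eq_bigr => b _.
  by rewrite !comp_lfunE -(dsum_projE (fiber_src b) u).
exists E, CO; split; split=> /=.
- move=> x v vx; apply/dsumP => y; rewrite dsum_ofE e0 ?[RHS]dsum_ofE //.
  by apply: contraNneq vx => ->; exact: (valP y).
- move=> x v w vx; rewrite COE.
  pose y0 : fiber0 g x := exist _ (qmor0 F v) (introT eqP vx).
  rewrite (bigD1 y0) //= dsum_ofE cod // big1 ?addr0 // => y yy0.
  rewrite dsum_ofE e0 ?linear0 //.
  by apply: contraNneq yy0 => vy; apply/eqP/val_inj.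
- move=> x u; apply/dsumP => y; rewrite linear_sum {1}(ex _ (dsum_at y u)).
  apply: eq_bigr => v _; rewrite linearZ /= dsum_ofE.
  have [vy | vy] := eqVneq (qmor0 F v) (val y); last by rewrite e0 // !scaler0.
  congr (_ *: _); rewrite COE (bigD1 y) //= big1 ?addr0 // => y' yy'.
  apply: (coord_out _ fb); rewrite vy; apply: contraNneq yy' => yy'.
  by apply/eqP/val_inj.
- move=> c cC; apply/dsumP => y; rewrite mapE dsum_ofE.
  pose b0 : fiber1 g (qmor1 g (qmor1 F c)) := exist _ (qmor1 F c) (eqxx _).
  (* Any other [b] in the fiber starts at another vertex, where this basis vector has component
     0. *)
  rewrite (bigD1 b0) //= big1 ?addr0 => [|b bb0]; last first.
    rewrite dsum_ofE /= e0 ?linear0 ?linear0 ?linear0 //.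
    apply: contraNneq bb0 => cb; apply/eqP/val_inj/srcQ' => /=.
    by rewrite -cb qmor_src.
  rewrite dsum_ofE /= ma // dsum_injE.
  rewrite /dfwith; case: eqP => [yE | ny]; first by case: _ / yE.
  rewrite e0 //; apply/eqP => ty; apply: ny; apply: val_inj => /=.
  by rewrite qmor_tgt.
- move=> a v no_c; apply/dsumP => y; rewrite mapE big1 ?[RHS]dsum_ofE // => b _.
  by rewrite dsum_ofE /= za // linear0 dsum_ofE.
Qed.

End Pushforward.

(** * Forests and the removal of an arrow *)

Section Forest.

Variables (T : quiver) (C : {set arrow T}).
Implicit Types (u v w : vertex T) (b c : arrow T).

Definition forest_rel : rel (vertex T) :=
  [rel v w | [exists c in C, (src c == v) && (tgt c == w)]].

(** Oriented towards the roots: the subtree above [y] consists of the [v] with [forest_le v y]. *)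
Definition forest_le := connect forest_rel.

Lemma forest_le_arrow c : c \in C -> forest_le (src c) (tgt c).
Proof. by move=> cC; apply/connect1/existsP; exists c; rewrite cC !eqxx. Qed.

Lemma forest_le_connect v w : forest_le v w -> connect (@arrow_rel T) v w.
Proof.
apply: connect_sub => {}v {}w /existsP[c /and3P[_ cv cw]].
by apply/connect1/existsP; exists c; rewrite cv.
Qed.

Variant forest_le_spec v w : Prop :=
| ForestRefl of v = w
| ForestStep c of c \in C & src c = v & forest_le (tgt c) w.

Lemma forest_leP v w : forest_le v w -> forest_le_spec v w.
Proof.
move=> /connectP[[|u p] /= ]; first by move=> _ ->; left.
move=> /andP[/existsP[c /and3P[cC /eqP cv /eqP cu]] up] ->.
by right with c => //; apply/connectP; exists p; rewrite cu.
Qed.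

Lemma forest_le_ind w (P : vertex T -> Prop) :
  P w -> (forall c, c \in C -> forest_le (tgt c) w -> P (tgt c) -> P (src c)) ->
  forall v, forest_le v w -> P v.
Proof.
move=> Pw PS v /connectP[p]; elim: p v => [|u p IH] v /=; first by move=> _ <-.
move=> /andP[/existsP[c /and3P[cC /eqP <- /eqP cu]] up] pw.
apply: PS => //; last by rewrite cu; apply: IH.
by rewrite cu; apply/connectP; exists p.
Qed.

Hypotheses (srcT : injective (@src T)) (acycT : has_no_dicycle T).

(** Each vertex has at most one outgoing arrow, so of two paths from [u] one is an initial part of
    the other. *)
Lemma forest_le_total u v w :
  forest_le u v -> forest_le u w -> forest_le v w \/ forest_le w v.
Proof.
move=> uv; elim/forest_le_ind: u / uv => [|c cC cv IH]; first by left.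
move=> cw; have [<- | b _ /srcT -> ] := forest_leP cw; last exact: IH.
by right; apply: connect_trans cv; apply: forest_le_arrow.
Qed.

Lemma forest_le_acyclic c : ~~ forest_le (tgt c) (src c).
Proof. by apply: contra (acycT c); apply: forest_le_connect. Qed.

Definition forest_root v := [forall c in C, src c != v].

Lemma forest_root_max r v : forest_root r -> forest_le r v -> r = v.
Proof.
move=> /forall_inP rr /forest_leP[] // c /rr cr rE.
by rewrite rE eqxx in cr.
Qed.

Lemma forest_root_uniq v r r' :
  forest_root r -> forest_root r' -> forest_le v r -> forest_le v r' -> r = r'.
Proof.
move=> rr rr' vr vr'; have [] := forest_le_total vr vr'.
  exact: forest_root_max.
by move/(forest_root_max rr').
Qed.

Lemma forest_root_ex v : exists2 r, forest_root r & forest_le v r.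
Proof.
have [n] := ubnP (height v); elim: n v => // n IH v; rewrite ltnS => le_n.
have [rv | ] := boolP (forest_root v); first by exists v => //; apply: connect0.
rewrite negb_forall_in => /exists_inP[c cC]; rewrite negbK => /eqP cv.
have [|r rr cr] := IH (tgt c).
  by apply: leq_trans le_n; rewrite -cv; apply: height_arrow.
exists r => //; apply: connect_trans cr; rewrite -cv; exact: forest_le_arrow.
Qed.

(** If [src c] were the root, [c] would close a directed cycle; otherwise the path to the root
    leaves by the only arrow out of [src c]. Hence a component is a full subquiver of [T], even
    after arrows have been removed. *)
Lemma forest_component_full c r :
  forest_root r -> forest_le (src c) r -> forest_le (tgt c) r -> c \in C.
Proof.
move=> rr /forest_leP[rE tr | b bC /srcT <- //].
by have := forest_le_acyclic c; rewrite rE tr.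
Qed.

Lemma forest_component_closed c r :
  forest_root r -> c \in C -> forest_le (src c) r = forest_le (tgt c) r.
Proof.
move=> /forall_inP rr cC; apply/idP/idP => [/forest_leP[rE | b _ /srcT -> //] | ].
  by have := rr c cC; rewrite rE eqxx.
by apply: connect_trans; apply: forest_le_arrow.
Qed.

End Forest.

Section Cut.

Variables (k : fieldType) (T Q : quiver) (F : qmor T Q) (C : {set arrow T}).
Hypotheses (srcT : injective (@src T)) (acycT : has_no_dicycle T).
Hypothesis srcQ : injective (@src Q).

(* [h] maps the subtree above [src b] into the subtree above a sibling of
   [src b], over [Q]. *)
Definition sibling_map (b : arrow T) (h : {ffun vertex T -> vertex T}) : bool :=
  [&& [forall w, forest_le C w (src b) ==> (qmor0 F (h w) == qmor0 F w)],
      [forall c in C, forest_le C (tgt c) (src b) ==>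
        [exists c' in C, (src c' == h (src c)) && (tgt c' == h (tgt c))]]
    & [exists b' in C, [&& b' != b, src b' == h (src b) & tgt b' == tgt b]]].

Section SiblingMap.

Variables (b : arrow T) (h : {ffun vertex T -> vertex T}).
Hypotheses (bC : b \in C) (hb : sibling_map b h).

Let D w := forest_le C w (src b).

Lemma sibling_map_fiber w : D w -> qmor0 F (h w) = qmor0 F w.
Proof. by case/and3P: hb => /forallP/(_ w)/implyP h1 _ _ /h1/eqP. Qed.

Lemma sibling_map_arrow c : c \in C -> D (tgt c) ->
  exists c', [/\ c' \in C, src c' = h (src c) & tgt c' = h (tgt c)].
Proof.
case/and3P: hb => _ /forall_inP h2 _ /h2/implyP h2' /h2'.
by move=> /exists_inP[c' c'C /andP[/eqP s /eqP t]]; exists c'.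
Qed.

Lemma sibling_map_base :
  exists b', [/\ b' \in C, b' != b, src b' = h (src b) & tgt b' = tgt b].
Proof.
case/and3P: hb => _ _ /exists_inP[b' b'C /and3P[b'b /eqP s /eqP t]].
by exists b'.
Qed.

Lemma sibling_map_le w : D w -> forest_le C (h w) (h (src b)).
Proof.
move=> Dw; elim/forest_le_ind: w / Dw => [|c cC Dc IH]; first exact: connect0.
have [c' [c'C <- tc']] := sibling_map_arrow cC Dc.
by apply: connect_trans IH; rewrite -tc'; apply: forest_le_arrow.
Qed.

(** Otherwise [src b] and [h (src b)] both lie on the path out of [h w] and are comparable; but they
    are distinct with a common target, which would give a directed cycle. *)
Lemma sibling_map_disjoint w : D w -> ~~ D (h w).
Proof.
move=> /sibling_map_le hw; apply/negP => Dhw.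
have [b' [b'C b'b sb' tb']] := sibling_map_base.
case: (forest_le_total srcT Dhw hw) => /forest_leP[].
- by rewrite -sb' => /srcT bb'; rewrite bb' eqxx in b'b.
- move=> c _ /srcT ->; rewrite -tb' -sb'; apply/negP; exact: forest_le_acyclic.
- by rewrite -sb' => /srcT bb'; rewrite bb' eqxx in b'b.
- move=> c _; rewrite -sb' => /srcT ->; rewrite tb'; apply/negP; exact: forest_le_acyclic.
Qed.

(** Let [N] send the vector of [v] to that of [h v] for [v] in [D] and to 0 otherwise. Disjointness
    of [D] and its image gives [N] square 0, so [1 - N] has inverse [1 + N]. The vectors at [src b]
    and [h (src b)] have the same image, so their difference is killed. *)
Lemma presented_cut (V : rep k Q) : presented F C V -> presented F (C :\ b) V.
Proof.
move=> [e [co [fb [mC zC]]]]; have [e0 _ _] := fb.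
pose eh x v : V x := if D v then e x (h v) else 0.
have eh0 x v : qmor0 F v != x -> eh x v = 0.
  by rewrite /eh; case: ifP => // Dv vx; rewrite e0 // sibling_map_fiber.
pose N := basis_hom co eh.
have NE x v : N x (e x v) = eh x v by apply: (basis_homE _ fb) => w; apply: eh0.
have NN x u : N x (N x u) = 0.
  rewrite -comp_lfunE -[RHS](@zero_lfunE _ _ (V x) u); move: u; apply/lfunP.
  apply: (fiber_bases_hom_ext fb) => v _; rewrite comp_lfunE zero_lfunE NE /eh.
  case: ifP => [Dv|_]; last by rewrite linear0.
  by rewrite NE /eh (negPf (sibling_map_disjoint Dv)).
pose f x := (\1 - N x)%VF; pose g x := (\1 + N x)%VF.
have fE x u : f x u = u - N x u by rewrite add_lfunE opp_lfunE id_lfunE.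
have gE x u : g x u = u + N x u by rewrite add_lfunE id_lfunE.
have feE x v : f x (e x v) = e x v - eh x v by rewrite fE NE.
exists (fun x v => f x (e x v)), (fun x v => (co x v \o g x)%VF); split.
  apply: fiber_bases_change => // x u.
    by rewrite gE fE linearB /= NN subr0 subrK.
  by rewrite fE gE linearD /= NN addr0 addrK.
split=> [c | a v no_c].
  rewrite in_setD1 => /andP[cb cC]; rewrite !feE linearB /= mC // /eh.
  (* The only arrow of [C] leaving [D] is [b]. *)
  have -> : D (src c) = D (tgt c).
    apply/idP/idP => [/forest_leP[/srcT cE | c' _ /srcT -> //] | ].
      by rewrite cE eqxx in cb.
    by apply: connect_trans; apply: forest_le_arrow.
  case: ifP => [Dc | _]; last by rewrite linear0.
  have Dsc : D (src c) by apply: connect_trans Dc; apply: forest_le_arrow.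
  have [c' [c'C sc' tc']] := sibling_map_arrow cC Dc.
  have Fc' : qmor1 F c' = qmor1 F c.
    by apply: srcQ; rewrite !qmor_src sc' sibling_map_fiber.
  by have := mC c' c'C; rewrite Fc' sc' tc' => ->.
rewrite feE linearB /eh /=; have [vb | vb] := eqVneq v (src b).
  have [b' [b'C b'b sb' tb']] := sibling_map_base.
  have Db : D (src b) by apply: connect0.
  rewrite vb Db; have [Fb | Fb] := eqVneq (qmor1 F b) a.
    have Fb' : qmor1 F b' = qmor1 F b.
      by apply: srcQ; rewrite !qmor_src sb' sibling_map_fiber.
    have := mC b' b'C; rewrite Fb' sb' tb'; case: _ / Fb => ->.
    by rewrite mC // subrr.
  (* An arrow of [Q] is determined by its source. If [a] is not [qmor1 F b], both vectors lie
     outside of the fiber over [src a] and are 0. *)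
  have va : qmor0 F (src b) != src a.
    by apply: contraNneq Fb => Fb; apply/eqP/srcQ; rewrite qmor_src.
  by rewrite !e0 ?sibling_map_fiber // linear0 subr0.
have no_c' c : c \in C -> src c != v.
  move=> cC; have [-> | cb] := eqVneq c b; first by rewrite eq_sym.
  by apply: no_c; rewrite in_setD1 cb.
(* A path from [v] to [src b] would start with an arrow of [C] out of [v]; there is none, so [v] is
   not in [D]. *)
rewrite zC // ifN; first by rewrite linear0 subr0.
apply/negP => /forest_leP[vE | c cC cv].
  by rewrite vE eqxx in vb.
by have := no_c' c cC; rewrite cv eqxx.
Qed.

End SiblingMap.

End Cut.

(** * Direct sums and coefficient quivers *)

Lemma sum_insub (X : finType) (P : pred X) (M : nmodType) (G : {x | P x} -> M) :
  \sum_x oapp G 0 (insub x) = \sum_u G u.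
Proof.
rewrite (bigID P) /= [X in _ + X]big1 ?addr0 => [|x Px]; last by rewrite insubF ?(negPf Px).
rewrite (reindex_omap (fun u : {x | P x} => val u) insub) /= => [|x Px]; last by rewrite insubT.
apply: eq_big => [u | u _]; last by rewrite valK.
by rewrite valK eqxx (valP u).
Qed.

Section DirectSum.

Variables (k : fieldType) (T Q : quiver) (F : qmor T Q) (C : {set arrow T}).
Variables (I : finType) (P : I -> pred (vertex T)) (own : vertex T -> I).
Variable W : I -> rep k Q.
Hypothesis PE : forall i v, P i v = (own v == i).
Hypothesis P_full : forall i c, P i (src c) -> P i (tgt c) -> c \in C.
Hypothesis P_closed : forall i c, c \in C -> P i (src c) = P i (tgt c).

Lemma rep_dsum_mapE a u i :
  dsum_at i (rep_map (rep_dsum W) a u) = rep_map (W i) a (dsum_at i u).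
Proof.
rewrite /= sum_lfunE linear_sum (bigD1 i) //= big1 ?addr0 => [|j ji].
  by rewrite !comp_lfunE dsum_projE dsum_injE dfwith_in.
by rewrite !comp_lfunE dsum_injE dfwith_out.
Qed.

(** [own] makes the [P i] a partition. By [P_full] and [P_closed], the forest with arrows [C] is the
    disjoint union of the full subquivers on its parts, so the bases of the summands combine. *)
Lemma presented_dsum :
  (forall i, presented (qmor_comp (subquiver_incl (P i)) F) setT (W i)) ->
  presented F C (rep_dsum W).
Proof.
move=> /fin_all_exists[e /fin_all_exists[co H]].
(* [insub v] is [None] outside of part [i], which gives component 0 there. *)
pose E x v : rep_dsum W x :=
  dsum_of (fun i => oapp (e i x) 0 (insub v : option {v | P i v}) : W i x).
pose CO x v : 'Hom(rep_dsum W x, k^o) := (\sum_i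
  (oapp (co i x) 0 (insub v : option {v | P i v}) \o
   dsum_proj (fun i => W i x) i))%VF.
have COE x v (u : rep_dsum W x) i : P i v ->
    CO x v u = oapp (co i x) 0 (insub v : option {v | P i v}) (dsum_at i u).
  move=> Pv; rewrite sum_lfunE (bigD1 i) //= big1 ?addr0 => [|j ji].
    by rewrite comp_lfunE dsum_projE.
  rewrite comp_lfunE insubF ?zero_lfunE // PE.
  by move: Pv; rewrite PE => /eqP ->; rewrite eq_sym (negPf ji).
exists E, CO; split; split=> /=.
- move=> x v vx; apply/dsumP => i; rewrite !dsum_ofE.
  case: insubP => //= s _ sv; have [[e0 _ _] _] := H i.
  by rewrite e0 //= sv.
- move=> x v w vx; have Pw : P (own w) w by rewrite PE.
  have [[_ cod _] _] := H (own w).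
  rewrite (COE _ _ _ _ Pw) dsum_ofE (insubT _ Pw) /=.
  case: insubP => [s _ sv | nPv] /=; first by rewrite cod /= ?sv // -val_eqE /= sv.
  by rewrite linear0; case: eqP => // vw; rewrite vw Pw in nPv.
- move=> x u; apply/dsumP => i; have [[_ _ ex] _] := H i.
  rewrite {1}(ex x (dsum_at i u)) -sum_insub linear_sum.
  apply: eq_bigr => v _; rewrite linearZ /= dsum_ofE.
  case: insubP => [s Pv sv | _] /=; last by rewrite scaler0.
  rewrite (COE _ _ _ _ Pv) insubT /=; congr (co i x _ _ *: _).
  exact: val_inj.
- move=> c cC; apply/dsumP => i; rewrite rep_dsum_mapE !dsum_ofE.
  have [_ [m _]] := H i.
  have [Ps | nPs] := boolP (P i (src c)); last first.
    by rewrite !insubF ?linear0 // -?(P_closed i cC); apply: negbTE.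
  have Pt : P i (tgt c) by rewrite -P_closed.
  have Pc : P i (src c) && P i (tgt c) by rewrite Ps Pt.
  pose c' : arrow (full_subquiver (P i)) := exist _ c Pc.
  rewrite !insubT /=; have := m c' (in_setT c').
  rewrite (_ : src c' = Sub (src c) Ps); last exact: val_inj.
  by rewrite (_ : tgt c' = Sub (tgt c) Pt); last exact: val_inj.
- move=> a v no_c; apply/dsumP => i; rewrite rep_dsum_mapE !dsum_ofE.
  case: insubP => [s Ps sv | _] /=; last by rewrite linear0.
  have [_ [_ z]] := H i; apply: z => c' _; apply/eqP => c's.
  have /andP[Psc Ptc] := valP c'.
  have := no_c _ (P_full Psc Ptc).
  by rewrite -sv -c's /= eqxx.
Qed.

End DirectSum.

Section Rescaling.

Variables (k : fieldType) (T : quiver) (coef : arrow T -> k).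
Hypotheses (srcT : injective (@src T)) (acycT : has_no_dicycle T).
Hypothesis coef_neq0 : forall c, coef c != 0.

(* Multiplying the basis vector at [v] by the inverse of the product of the
   coefficients along the path from [v] to the root makes all coefficients 1. *)
Definition rescaling (v : vertex T) : k :=
  \prod_(c : arrow T | connect (@arrow_rel T) v (src c)) (coef c)^-1.

Lemma rescaling_neq0 v : rescaling v != 0.
Proof. by apply/prodf_neq0 => c _; rewrite invr_eq0. Qed.

(** The path from [src c] consists of [c] and the path from [tgt c]; acyclicity keeps [c] out of the
    latter. *)
Lemma rescaling_arrow c : rescaling (src c) * coef c = rescaling (tgt c).
Proof.
rewrite /rescaling (bigD1 c) ?connect0 //= mulrC mulVKf //.
apply: eq_bigl => c'; apply/andP/idP => [[/walk_connect[p wp] nc] | cc'].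
  case: p wp => [/eqP /srcT cE | c1 p /= /andP[/eqP/srcT -> wp]].
    by rewrite cE eqxx in nc.
  by apply/walk_connect; exists p.
split; first by apply: connect_trans cc'; apply/connect1/arrow_rel_arrow.
by apply: contraTneq cc' => ->; apply: acycT.
Qed.

End Rescaling.

Section CoefficientQuiver.

Variables (k : fieldType) (Q : quiver) (V : rep k Q).
Variable B : forall x, (\dim {:V x}).-tuple (V x).
Hypothesis basisB : forall x, basis_of {:V x} (B x).

Notation T := (coef_quiver B).

Fact coef_proj_src (c : arrow T) : src (tag (val c)) = tag (src c).
Proof. by case: c => -[a []]. Qed.
Fact coef_proj_tgt (c : arrow T) : tgt (tag (val c)) = tag (tgt c).
Proof. by case: c => -[a []]. Qed.
Definition coef_proj : qmor T Q :=
  @QMor T Q tag (fun c => tag (val c)) coef_proj_src coef_proj_tgt.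

Hypotheses (srcT : injective (@src T)) (acycT : has_no_dicycle T).

Lemma coef_expand a j : rep_map V a (B (src a))`_j =
  \sum_i coord (B (tgt a)) i (rep_map V a (B (src a))`_j) *: (B (tgt a))`_i.
Proof. exact: coord_basis (basisB _) (memvf _). Qed.

(** Two non-zero coefficients in one column would be two arrows with the same source. So each basis
    vector goes to 0 or to a multiple of one basis vector, and the rescaling turns the factor into
    1. *)
Lemma presented_coef : presented coef_proj setT V.
Proof.
pose lam := rescaling (fun c : arrow T => coefficient B (val c)).
have lam0 v : lam v != 0 by apply: rescaling_neq0 => c; apply: (valP c).
have lam_arrow c : lam (src c) * coefficient B (val c) = lam (tgt c).
  by apply: rescaling_arrow => // {}c; apply: (valP c).
(* [untag 0] transports the index if [v] lies over [x], and gives the default 0 otherwise. *)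
pose e0 x (v : vertex T) : V x :=
  untag 0 (fun i : 'I_(\dim {:V x}) => (B x)`_i) v.
pose co0 x (v : vertex T) : 'Hom(V x, k^o) :=
  untag 0 (fun i => linfun (coord (B x) i : V x -> k^o)) v.
have e0_out x v : tag v != x -> e0 x v = 0 by move=> vx; rewrite /e0 untag_dflt.
pose Tv x i : vertex T := existT (fun x => 'I_(\dim {:V x})) x i.
have e0E x i : e0 x (Tv x i) = (B x)`_i.
  exact: (untagE _ _ (erefl : tag (Tv x i) = x)).
have co0E x i : co0 x (Tv x i) = linfun (coord (B x) i : V x -> k^o).
  exact: (untagE _ _ (erefl : tag (Tv x i) = x)).
exists (fun x v => lam v *: e0 x v).
exists (fun x v => (lam v)^-1 *: co0 x v); split; split.
- by move=> x v vx; rewrite e0_out // scaler0.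
- move=> _ v w <-; rewrite scale_lfunE linearZ.
  case: v => x j /=; rewrite e0E.
  case: w => y i; have [yx | yx] := eqVneq y x; last first.
    rewrite /co0 untag_dflt // zero_lfunE !scaler0; case: eqP => // vw.
    by have := congr1 tag vw => /= xy; rewrite xy eqxx in yx.
  move: j; case: x / yx => j; rewrite co0E lfunE /= coord_free ?(basis_free (basisB y)) //.
  rewrite (_ : (_ == _ :> {_ & _}) = (j == i)); last first.
    by apply/eqP/eqP => [/eqP | ->] //; rewrite eq_Tagged => /eqP.
  have [-> | _] := eqVneq j i; last by rewrite !scaler0.
  by rewrite -[LHS]/(_^-1 * (_ * 1)) mulr1 mulVf ?lam0.
- move=> x u; pose G v := ((lam v)^-1 *: co0 x v)%VF u *: (lam v *: e0 x v).
  (* The vertices of the coefficient quiver are grouped by fiber; only the fiber over [x]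
     contributes. *)
  transitivity (\sum_y \sum_(i : 'I_(\dim {:V y})) G (Tv y i)); last first.
    by rewrite sig_big_dep; apply: eq_big => // -[].
  rewrite (bigD1 x) //= [X in _ + X]big1 ?addr0 => [|y yx]; last first.
    by apply: big1 => i _; rewrite /G e0_out ?scaler0.
  rewrite {1}(coord_basis (basisB x) (memvf u)); apply: eq_bigr => i _.
  rewrite /G scale_lfunE e0E co0E lfunE /=.
  by rewrite scalerA [_ *: _ * _]mulrAC mulVf ?lam0 ?mul1r.
- move=> c _; rewrite linearZ -lam_arrow -scalerA; congr (_ *: _).
  case: c => -[a [j i]] ce /=; rewrite !e0E [LHS]coef_expand (bigD1 i) //= big1 ?addr0 // => i' i'i.
  apply/eqP; rewrite scaler_eq0; apply/orP; left.
  apply: contraNT i'i => ci'.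
  pose c' : arrow T := exist (fun e => coefficient B e != 0) (existT _ a (j, i')) ci'.
  have /srcT : src c' = src (exist _ (existT _ a (j, i)) ce : arrow T) by [].
  by move=> /(congr1 (@tgt T))/eqP; rewrite eq_Tagged => /eqP /= ->.
- move=> a v no_c; have [va | va] := eqVneq (tag v) (src a); last first.
    by rewrite e0_out // scaler0 linear0.
  have : rep_map V a (e0 (src a) v) = 0; last first.
    by rewrite linearZ /= => ->; rewrite scaler0.
  case: v va no_c => x j /= /esym ax; case: x / ax j => j no_c.
  rewrite e0E coef_expand big1 // => i _.
  apply/eqP; rewrite scaler_eq0; apply/orP; left; apply/negPn/negP => ci.
  pose c : arrow T := exist (fun e => coefficient B e != 0) (existT _ a (j, i)) ci.
  by have := no_c c (in_setT c); rewrite eqxx.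
Qed.

End CoefficientQuiver.

(** * Components of a forest *)

Lemma full_subquiver_no_cycle (T : quiver) (P : pred (vertex T)) :
  (forall c, ~~ @is_graph_cycle T c) ->
  forall c, ~~ @is_graph_cycle (full_subquiver P) c.
Proof.
move=> nc c; pose f (s : step (full_subquiver P)) : step T := (val s.1, s.2).
have fsrc s : step_src (f s) = val (step_src s) by rewrite /step_src /=; case: s.2.
have ftgt s : step_tgt (f s) = val (step_tgt s) by rewrite /step_tgt /=; case: s.2.
apply: contra (nc (map f c)) => /and4P[c0 cc usrc uarr].
rewrite /is_graph_cycle size_map c0 -!map_comp cycle_map /=; apply/and3P; split.
- by apply: sub_cycle cc => s t /= /eqP st; rewrite fsrc ftgt st.
- rewrite (eq_map (g := (fun v : vertex (full_subquiver P) => val v) \o (@step_src (full_subquiver P)))) //.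
  by rewrite map_comp map_inj_uniq //; apply: val_inj.
- rewrite (eq_map (g := (fun a : arrow (full_subquiver P) => val a) \o fst)) //.
  by rewrite map_comp map_inj_uniq //; apply: val_inj.
Qed.

Lemma full_subquiver_src_inj (T : quiver) (P : pred (vertex T)) :
  injective (@src T) -> injective (@src (full_subquiver P)).
Proof. by move=> srcT a b /(congr1 val) /= /srcT /val_inj. Qed.

Section Component.

Variables (T Q : quiver) (F : qmor T Q) (C : {set arrow T}) (r : vertex T).
Hypotheses (srcT : injective (@src T)) (acycT : has_no_dicycle T).
Hypothesis ncT : forall c, ~~ @is_graph_cycle T c.
Hypotheses (srcQ : injective (@src Q)) (acycQ : has_no_dicycle Q).
Hypothesis rr : forest_root C r.

Let P : pred (vertex T) := fun v => forest_le C v r.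
Let S := full_subquiver P.
Let Pr : P r. Proof. exact: connect0. Qed.
Let rS : vertex S := exist _ r Pr.

Lemma component_ind (X : vertex S -> Prop) :
  X rS -> (forall c : arrow S, X (tgt c) -> X (src c)) -> forall v, X v.
Proof.
move=> Xr XS [v Pv]; have vr := Pv.
elim/forest_le_ind: v / vr Pv => [|c cC cr IH] Pv.
  by rewrite (_ : exist _ r Pv = rS) //; apply: val_inj.
have Pc : P (src c) && P (tgt c) by rewrite Pv.
pose c' : arrow S := exist _ c Pc.
rewrite (_ : exist _ (src c) Pv = src c'); last exact: val_inj.
apply: XS; rewrite (_ : tgt c' = exist _ (tgt c) cr); last exact: val_inj.
exact: IH.
Qed.

Lemma component_root v : is_root v = (v == rS).
Proof.
apply/idP/eqP => [|->].
  elim/component_ind: v => // c _ /eqP/card0_eq/(_ c).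
  by rewrite !inE eqxx.
apply/eqP/eq_card0 => c; rewrite !inE; apply/negP => /eqP/(congr1 val) /= cr.
have /andP[_ Pt] := valP c.
by have := forest_le_acyclic C acycT (val c); rewrite cr; case/negP.
Qed.

Lemma component_tree : is_rooted_tree S.
Proof.
have to_root v : connect (@edge_rel S) v rS.
  elim/component_ind: v => // c; apply: connect_trans; apply: connect1.
  by rewrite /edge_rel /= arrow_rel_arrow.
have edge_sym : connect_sym (@edge_rel S).
  by apply: sym_connect_sym => x y; rewrite /edge_rel /= orbC.
split; last first.
  by exists rS; split; [rewrite component_root | move=> v; rewrite component_root => /eqP].
split; last exact: full_subquiver_no_cycle.
split; first by apply/card_gt0P; exists rS.
by move=> x y; apply: connect_trans (to_root x) _; rewrite edge_sym.
Qed.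

(** [F] carries the path from [v] to [r] to a path in [Q]; hence the component maps to the down
    quiver of the image of [r]. *)
Fact component_leQ (v : vertex S) : leQ (qmor0 F (val v)) (qmor0 F r).
Proof.
elim/component_ind: v => [|c]; first exact: connect0.
apply: connect_trans; rewrite /= -qmor_src -qmor_tgt.
exact/connect1/arrow_rel_arrow.
Qed.

Fact component_leQ_arrow (c : arrow S) :
  leQ (src (qmor1 F (val c))) (qmor0 F r) &&
  leQ (tgt (qmor1 F (val c))) (qmor0 F r).
Proof.
rewrite qmor_src qmor_tgt.
by apply/andP; split; [apply: (component_leQ (src c)) | apply: (component_leQ (tgt c))].
Qed.

Definition component_mor0 (v : vertex S) : vertex (down_quiver (qmor0 F r)) :=
  exist _ (qmor0 F (val v)) (component_leQ v).
Definition component_mor1 (c : arrow S) : arrow (down_quiver (qmor0 F r)) :=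
  exist _ (qmor1 F (val c)) (component_leQ_arrow c).

Fact component_mor_src c : src (component_mor1 c) = component_mor0 (src c).
Proof. by apply: val_inj; rewrite /= qmor_src. Qed.
Fact component_mor_tgt c : tgt (component_mor1 c) = component_mor0 (tgt c).
Proof. by apply: val_inj; rewrite /= qmor_tgt. Qed.

Definition component_mor : qmor S (down_quiver (qmor0 F r)) :=
  QMor component_mor_src component_mor_tgt.

Lemma component_preserves_root : preserves_root component_mor.
Proof.
move=> v; rewrite component_root => /eqP ->.
apply/eqP/eq_card0 => a; rewrite !inE; apply/negP => /eqP/(congr1 val) /= ar.
have /andP[_ ta] := valP a.
by have := acycQ (val a); rewrite ar; case/negP.
Qed.

(** An endomorphism fixes the root. Going up from there, an arrow with fixed target and moved source
    would yield a sibling map. Arrows are then fixed as well, being determined by their sources. *)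
Lemma component_reduced :
  (forall b h, b \in C -> ~~ sibling_map F C b h) -> is_reduced component_mor.
Proof.
move=> no_sib g [g_root gF _].
(* Values outside of the component are arbitrary: the subtree above [src c] lies inside it. *)
pose h := [ffun v => if insub v is Some v' then val (qmor0 g v') else v].
have hE v : h (val v) = val (qmor0 g v) by rewrite ffunE valK.
have g_id v : qmor0 g v = v.
  elim/component_ind: v => [|c IH].
    by apply/eqP; rewrite -component_root; apply: g_root; rewrite component_root.
  have inC (d : arrow S) : val d \in C.
    by have /andP[] := valP d; apply: forest_component_full.
  apply/eqP; apply: contraT => g_src.
  have := no_sib (val c) h (inC c); rewrite /sibling_map; case/negP; apply/and3P; split.
  - apply/forallP => w; apply/implyP => wc.
    have Pw : P w by apply: connect_trans wc (valP (src c)).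
    have := hE (exist _ w Pw); rewrite /= => ->.
    by apply/eqP; have /(congr1 val) := gF (exist _ w Pw).
  - apply/forall_inP => d dC; apply/implyP => dc.
    have Pt : P (tgt d) by apply: connect_trans dc (valP (src c)).
    have Ps : P (src d) by apply: connect_trans Pt; apply: forest_le_arrow.
    have Pd : P (src d) && P (tgt d) by rewrite Ps.
    pose d' : arrow S := exist _ d Pd.
    apply/exists_inP; exists (val (qmor1 g d')) => //.
    have /(congr1 val) /= -> := qmor_src g d'.
    have /(congr1 val) /= -> := qmor_tgt g d'.
    by rewrite -!hE !eqxx.
  - apply/exists_inP; exists (val (qmor1 g c)) => //.
    have /(congr1 val) /= gs := qmor_src g c.
    have /(congr1 val) /= gt := qmor_tgt g c.
    have gs' := hE (src c); rewrite /= in gs'.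
    rewrite gs gt gs' IH !eqxx !andbT; apply: contraNneq g_src => gc.
    by apply/eqP/val_inj; rewrite /= -gs gc.
split=> // c; apply: (full_subquiver_src_inj srcT).
by rewrite qmor_src g_id.
Qed.

Variable k : fieldType.

Definition component_rep : rep k Q :=
  pushforward (down_incl (qmor0 F r)) (linearization k component_mor).

(** The constant representation is pushed forward twice. The composite morphisms agree with the
    stated one by conversion on vertices and arrows, and [presented] depends on nothing else. *)
Lemma presented_component :
  presented (qmor_comp (subquiver_incl P) F) setT component_rep.
Proof.
apply: (presented_pushforward (F := component_mor)).
  exact: full_subquiver_src_inj.
apply: (presented_pushforward (F := qmor_id S)); first exact: full_subquiver_src_inj.
exact: presented_constant.
Qed.

End Component.

(** * Splitting into reduced components *)

Lemma rep_iso_refl (k : fieldType) (Q : quiver) (V : rep k Q) : rep_iso V V.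
Proof.
exists (fun x => \1%VF); split=> [x | a]; last by rewrite comp_lfun1l comp_lfun1r.
by exists id => u; rewrite id_lfunE.
Qed.

Section Decomposition.

Variables (k : fieldType) (T Q : quiver) (F : qmor T Q).
Hypotheses (srcT : injective (@src T)) (acycT : has_no_dicycle T).
Hypothesis ncT : forall c, ~~ @is_graph_cycle T c.
Hypotheses (srcQ : injective (@src Q)) (acycQ : has_no_dicycle Q).

Lemma presented_decomposition (C : {set arrow T}) (V : rep k Q) :
  presented F C V ->
  exists (n : nat) (W : 'I_n -> rep k Q),
    (forall i : 'I_n, is_reduced_rooted_tree_module (W i)) /\
    rep_iso V (rep_dsum W).
Proof.
have [n] := ubnP #|C|; elim: n C => // n IH C; rewrite ltnS => le_n VC.
have [/exists_inP[b bC /existsP[h hb]] | no_sib] :=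
    boolP [exists b in C, [exists h, sibling_map F C b h]].
  apply: (IH (C :\ b)); last exact: (presented_cut srcT acycT srcQ bC hb VC).
  by rewrite (cardsD1 b) bC in le_n.
(* Nothing can be cut any more. The summands are indexed by the roots of the forest, and [own]
   selects the root reached from a vertex. *)
pose R := [pred r | forest_root C r].
pose root_of (i : 'I_#|R|) : vertex T := enum_val i.
have rootP i : forest_root C (root_of i) by have := enum_valP i.
have [own ownP] : exists own : vertex T -> 'I_#|R|,
    forall v, forest_le C v (root_of (own v)).
  apply: (fin_all_exists (P := fun v i => forest_le C v (root_of i))) => v.
  have [r rr vr] := forest_root_ex C acycT v.
  by exists (enum_rank_in (rr : r \in R) r); rewrite /root_of enum_rankK_in.
exists #|R|, (fun i => component_rep F C (root_of i) k); split=> [i | ].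
  exists (qmor0 F (root_of i)), _, (component_mor F C (root_of i)).
  split; last exact: rep_iso_refl.
    by split; [apply: component_tree | apply: component_preserves_root].
  apply: component_reduced => // b h bC; apply: contra no_sib => hb.
  by apply/exists_inP; exists b => //; apply/existsP; exists h.
apply: presented_iso srcQ _ _ _ VC _.
apply: (presented_dsum (P := fun i v => forest_le C v (root_of i)) (own := own)).
- move=> i v; apply/idP/eqP => [vi | <- //].
  by apply: enum_val_inj; apply: (forest_root_uniq srcT (v := v)).
- by move=> i c; apply: forest_component_full.
- by move=> i c; apply: forest_component_closed.
- by move=> i; apply: presented_component.
Qed.

End Decomposition.

Theorem theoremB (k : fieldType) (Q : quiver) (Qtree : is_rooted_tree Q)
    (V : rep k Q) (Vtree : is_rooted_tree_module V) :
  exists (n : nat) (W : 'I_n -> rep k Q),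
    (forall i : 'I_n, is_reduced_rooted_tree_module (W i)) /\
    rep_iso V (rep_dsum W).
Proof.
have [B [basisB Ttree]] := Vtree; have [[_ ncT] _] := Ttree.
have srcT := rooted_tree_src_inj Ttree.
have acycT := rooted_tree_no_dicycle Ttree.
(* Cutting starts from the set of all arrows of the coefficient quiver. *)
apply: presented_decomposition (presented_coef basisB srcT acycT) => //.
  exact: rooted_tree_src_inj.
exact: rooted_tree_no_dicycle.
Qed.
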